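(* Let $A\in\mathbb{C}^{q\times n}$, let $W\in\mathbb{C}^{n\times q}$ be nonzero, let $m$ be a positive integer and let $k=\max\{\mathrm{Ind}(AW),\mathrm{Ind}(WA)\}$. Then: (1) $A^{\mathrm{wg}_m,W,\dag}=W\left((AW)^mA^{\mathrm{cEP},W}WA\right)^{\#,W}WA^{\star m}A^{\dag}$; (2) $A^{\mathrm{wg}_m,W,\dag}=((WA)^D)^{m+1}P_{\mathcal{R}((WA)^k)}WA^{\star(m+1)}A^{\dag}$; (3) $A^{\mathrm{wg}_m,W,\dag}=WA^{\star l}W\left(WA^{\star(l+m+1)}W\right)^{\dag}WA^{\star(m+1)}A^{\dag}$, where $l\geq k$; (4) $A^{\mathrm{wg}_m,W,\dag}=W\left(WA^{\star(m+1)}WP_{\mathcal{R}((AW)^k)}\right)^{\dag}WA^{\star(m+1)}A^{\dag}$; (5) $A^{\mathrm{wg}_m,W,\dag}=WA^{\star(m-1)}W(A^{\star m})^{\mathrm{wg},W}WAA^{\dag}$; (6) $A^{\mathrm{wg}_m,W,\dag}=((WA)^{\mathrm{wg}})^{m}WA^{\star m}A^{\dag}$; (7) $A^{\mathrm{wg}_m,W,\dag}=(WA)^{\mathrm{wg}_m}WAA^{\dag}$.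
   Context: $M^{\dag}$, $\mathcal{R}(M)$ are the Moore-Penrose inverse and range of a complex matrix $M$; $P_{\mathcal{T}}$ is the orthogonal projector onto a subspace $\mathcal{T}$. For square $M$: $M^0=I$, $\mathrm{Ind}(M)$ is the smallest nonnegative integer $k$ with $\mathrm{rank}(M^k)=\mathrm{rank}(M^{k+1})$; $M^D$ is the Drazin inverse, called the group inverse $M^{\#}$ when $\mathrm{Ind}(M)\le 1$; the core-EP inverse $M^{\mathrm{cEP}}$ is the unique $X$ with $XMX=X$ and $\mathcal{R}(X)=\mathcal{R}(X^* )=\mathcal{R}(M^{\mathrm{Ind}(M)})$; the $m$-weak group inverse is $M^{\mathrm{wg}_m}=(M^{\mathrm{cEP}})^{m+1}M^m$, and the weak group inverse is $M^{\mathrm{wg}}=M^{\mathrm{wg}_1}=(M^{\mathrm{cEP}})^2M$. For $X,Y\in\mathbb{C}^{q\times n}$ the $W$-product is $X\star Y=XWY$, and $X^{\star l}$ is the $l$-fold $W$-product of $X$ with itself for $l\ge1$; by convention $X^{\star 0}W=I_q$ and $WX^{\star 0}=I_n$ (so $WX^{\star l}=(WX)^l$ for all $l\ge 0$). For $C\in\mathbb{C}^{q\times n}$: the weighted core-EP inverse is $C^{\mathrm{cEP},W}=C((WC)^{\mathrm{cEP}})^2$; the $W$-weighted Drazin inverse is $C^{D,W}=C((WC)^D)^2$, called the $W$-weighted group inverse $C^{\#,W}$ when $\max\{\mathrm{Ind}(CW),\mathrm{Ind}(WC)\}\le 1$; the $W$-weighted $m$-weak group inverse is $C^{\mathrm{wg}_m,W}=(C^{\mathrm{cEP},W})^{\star(m+1)}WC^{\star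 m}$, and the $W$-weighted weak group inverse is $C^{\mathrm{wg},W}=C^{\mathrm{wg}_1,W}$. The $W$-weighted $m$-weak group MP inverse is $A^{\mathrm{wg}_m,W,\dag}=WA^{\mathrm{wg}_m,W}WAA^{\dag}\in\mathbb{C}^{n\times q}$. *)

(* Defs.v *)
From HB Require Import structures.
From mathcomp Require Import all_boot all_order all_algebra.
From mathcomp Require Import sesquilinear spectral.
From mathcomp Require Import complex.
From mathcomp Require Import boolp classical_sets reals.

Set Implicit Arguments.
Unset Strict Implicit.
Unset Printing Implicit Defensive.

Import Order.TTheory GRing.Theory Num.Theory.
Local Open Scope ring_scope.
Local Open Scope sesquilinear_scope.

Section GeneralizedInverses.
Variable C : numClosedFieldType.

(* MathComp's [mxalgebra] works with row spaces; here a matrix acts on column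
   vectors, and its range is a subspace of the space of column vectors. *)
Definition mxrange p r (M : 'M[C]_(p, r)) : {vspace 'cV[C]_p} :=
  limg (linfun (mulmx M : 'cV[C]_r -> 'cV[C]_p)).

Lemma mxindex_subproof n (M : 'M[C]_n) :
  exists k, \rank (M ^+ k) == \rank (M ^+ k.+1).
Proof.
have [k [_ Hk]] : exists k, (k <= n.+1)%N /\
    (\rank (M ^+ k) == \rank (M ^+ k.+1)) ; last by exists k.
apply: contrapT => H.
have lt_rank k : (k <= n.+1)%N -> (\rank (M ^+ k) + k <= n)%N.
  elim: k => [|k IHk] lekn; first by rewrite addn0 rank_leq_row.
  have := IHk (ltnW lekn); rewrite addnS; apply: leq_trans.
  rewrite ltn_add2r ltn_neqAle eq_sym; apply/andP; split; last first.
    by rewrite exprS; apply: mxrankM_maxr.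
  by apply/negP => e; apply: H; exists k; split => //; apply: ltnW.
by have := lt_rank n.+1 (leqnn _); rewrite addnS ltnNge leq_addl.
Qed.

Definition mxindex n (M : 'M[C]_n) : nat := ex_minn (mxindex_subproof M).

(* The inverses and the projector below are the unique matrices satisfying the
   given predicates; such matrices always exist, so the default value 0 of
   [xget] is never used. *)

Definition is_orthproj n (T : {vspace 'cV[C]_n}) (P : 'M[C]_n) : Prop :=
  [/\ P *m P = P, P ^t* = P & mxrange P = T].

Definition orthproj n (T : {vspace 'cV[C]_n}) : 'M[C]_n :=
  xget 0 [set P | is_orthproj T P]%classic.

Definition is_MP p r (M : 'M[C]_(p, r)) (X : 'M[C]_(r, p)) : Prop :=
  [/\ M *m X *m M = M, X *m M *m X = X,
      (M *m X) ^t* = M *m X & (X *m M) ^t* = X *m M].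

Definition mpinv p r (M : 'M[C]_(p, r)) : 'M[C]_(r, p) :=
  xget 0 [set X | is_MP M X]%classic.

Definition is_drazin n (M X : 'M[C]_n) : Prop :=
  [/\ M ^+ (mxindex M).+1 *m X = M ^+ mxindex M,
      X *m M *m X = X & M *m X = X *m M].

Definition drazin n (M : 'M[C]_n) : 'M[C]_n :=
  xget 0 [set X | is_drazin M X]%classic.

Definition is_coreEP n (M X : 'M[C]_n) : Prop :=
  [/\ X *m M *m X = X, mxrange X = mxrange (X ^t*)
    & mxrange (X ^t*) = mxrange (M ^+ mxindex M)].

Definition coreEP n (M : 'M[C]_n) : 'M[C]_n :=
  xget 0 [set X | is_coreEP M X]%classic.

Definition wgm m n (M : 'M[C]_n) : 'M[C]_n := coreEP M ^+ m.+1 *m M ^+ m.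

Definition wg n (M : 'M[C]_n) : 'M[C]_n := wgm 1 M.

Section Weighted.
Variables q n : nat.
Variable W : 'M[C]_(n, q).
Implicit Types X Y : 'M[C]_(q, n).

Definition wprod X Y : 'M[C]_(q, n) := X *m W *m Y.

(* The l-fold W-product; meaningful for l >= 1 only (0 is a dummy value for
   l = 0, where only the product [Wwpow X 0] makes sense). *)
Definition wpow X l : 'M[C]_(q, n) := iterop l wprod X 0.

(* W X^{*l}, with the convention W X^{*0} = I_n; as X^{*0} W = I_q, the product
   W X^{*l} W is [Wwpow X l *m W] also for l = 0. *)
Definition Wwpow X l : 'M[C]_n := if l is 0 then 1%:M else W *m wpow X l.

Definition wcoreEP X : 'M[C]_(q, n) := X *m coreEP (W *m X) ^+ 2.

(* The weighted Drazin inverse is called the weighted group inverse when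
   [maxn (mxindex (X *m W)) (mxindex (W *m X)) <= 1]. *)
Definition wdrazin X : 'M[C]_(q, n) := X *m drazin (W *m X) ^+ 2.

Definition wwgm m X : 'M[C]_(q, n) := wpow (wcoreEP X) m.+1 *m Wwpow X m.

Definition wwg X : 'M[C]_(q, n) := wwgm 1 X.

Definition wwgmMP m X : 'M[C]_(n, q) :=
  W *m wwgm m X *m W *m X *m mpinv X.

End Weighted.

End GeneralizedInverses.

(* Main.v *)
Require Import Defs.
From mathcomp Require Import all_boot all_order all_algebra.
From mathcomp Require Import sesquilinear spectral.
From mathcomp Require Import complex boolp classical_sets reals.

Set Implicit Arguments.
Unset Strict Implicit.
Unset Printing Implicit Defensive.

Import Order.TTheory GRing.Theory Num.Theory.
Local Open Scope ring_scope.
Local Open Scope sesquilinear_scope.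

(* Put M = WA and let X be the core-EP inverse of M. Then M X^2 = X,
   X M^(l+1) = M^l for l >= Ind M, and M X is the orthogonal projector onto the
   range of M^l; these three relations characterise X. They give
   W A^{wg_m,W} = X^(m+1) M^m, so the left-hand side of every item is
   X^(m+1) M^(m+1) A^+. Each item then reduces to an identity for X^(m+1) or
   X^(m+1) M^m: in (1), X^(m+1) M is the group inverse of WB; in (5), the core-EP
   inverse of M^m is X^m; in (3) and (4) one has E (M^(m+1) E)^+ = X^(m+1) because
   E = X^(m+1) (M^(m+1) E) and M^(m+1) E (M^(m+1) E)^+ = M X. *)

(** * Ring identities that follow from [a x^2 = x] and [x a^(l+1) = a^l] *)

Section LeftInverseOnRange.
Variables (S : pzRingType) (a x : S) (l : nat).
Hypothesis axx : a * x ^+ 2 = x.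
Hypothesis xal : x * a ^+ l.+1 = a ^+ l.

Lemma mulr_exp_stable j : (l <= j)%N -> x * a ^+ j.+1 = a ^+ j.
Proof.
move=> lj; rewrite -[j](subnKC lj) -addSn exprD mulrA xal -exprD //.
Qed.

Lemma exp_mul_expX i j : a ^+ i * x ^+ (i + j).+1 = x ^+ j.+1.
Proof.
elim: i j => [|i IH] j; first by rewrite mul1r.
rewrite exprS -mulrA addSnnS IH.
by rewrite -[j.+2]addn2 addnC exprD mulrA axx -exprS.
Qed.

Lemma range_decomp j : x = a ^+ j * x ^+ j.+1.
Proof. by have := exp_mul_expX j 0; rewrite addn0. Qed.

(** Writing the right-hand [x] as [a^l x^(l+1)] raises the power of [a] until the left-hand [x] can
    cancel one factor. *)
Lemma mul_exp_sandwich i : x * a ^+ i.+1 * x = a ^+ i * x.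
Proof.
have {2}-> := range_decomp l.
rewrite mulrA -[x * _ * _]mulrA -exprD addSn mulr_exp_stable ?leq_addl //.
by rewrite exprD -mulrA -range_decomp.
Qed.

Lemma outer_inverse : x * a * x = x.
Proof. by have := mul_exp_sandwich 0; rewrite mul1r expr1. Qed.

Lemma expX_mul_exp i j : (l <= j)%N -> x ^+ i * a ^+ (i + j) = a ^+ j.
Proof.
move=> lj; elim: i => [|i IH]; first by rewrite mul1r.
rewrite exprSr -mulrA addSn mulr_exp_stable ?IH //.
by rewrite (leq_trans lj) ?leq_addl.
Qed.

Lemma expX_mul_exp_sandwich i : x ^+ i * a ^+ i * x = x.
Proof.
have {2}-> := range_decomp l.
rewrite mulrA -[x ^+ i * _ * _]mulrA -exprD.
by rewrite expX_mul_exp // -range_decomp.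
Qed.

Lemma expX_mul_expX i j : x ^+ i.+1 * a * x ^+ j.+1 = x ^+ (i + j).+1.
Proof.
rewrite exprSr [x ^+ j.+1]exprS -!mulrA [a * _]mulrA [x * _]mulrA.
by rewrite [x * (a * x)]mulrA outer_inverse -exprS -exprD addnS.
Qed.

(** Every inner [a] stands between powers of [x] and is absorbed by [x a x = x]. When [x] is the
    core-EP inverse of [a], the base is the weak group inverse. *)
Lemma expr_weak_group m : (x ^+ 2 * a) ^+ m.+1 = x ^+ m.+2 * a.
Proof.
elim: m => // m IH; rewrite exprS IH mulrA expX_mul_expX //.
Qed.

Variable m : nat.
(** For [a = WA] and [x] its core-EP inverse, this is the product [WB] of item (1). *)
Let t := a ^+ m.+1 * x ^+ 2 * a.
Let d := x ^+ m.+1 * a.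

Lemma mul_weak_group : t * d = x * a.
Proof.
rewrite /t /d mulrA -[_ * x ^+ 2 * a * _]mulrA -[_ * x ^+ 2 * _]mulrA.
rewrite (mulrA (x ^+ 2)) expX_mul_expX add1n.
by rewrite -(range_decomp m.+1).
Qed.

Lemma weak_group_mul : d * t = x * a.
Proof.
rewrite /t /d !mulrA -[_ * a * a ^+ _]mulrA -exprS.
rewrite -(mulrA _ x x) (exprSr a) (mulrA (x ^+ _)) -(mulrA _ a) -expr2 axx.
by rewrite expX_mul_exp_sandwich.
Qed.

(** Both products of [t] and [d] equal [x * a], which is a left identity for each of them; so [d] is
    the group inverse of [t]. *)
Lemma weak_group_inverse : [/\ d * t ^+ 2 = t, t * d = d * t & d * t * d = d].
Proof.
rewrite mul_weak_group expr2 mulrA weak_group_mul; split => //.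
  by rewrite /t !mulrA -[x * a * _]mulrA -exprS mul_exp_sandwich.
by rewrite /d mulrA -{1}[x]expr1 expX_mul_expX.
Qed.

End LeftInverseOnRange.

(** * Uniqueness of the Drazin inverse in a ring, with unrelated exponents *)

Section DrazinUniqueness.
Variables (S : pzRingType) (a x y : S) (i j : nat).
Hypotheses (ax : a * x = x * a) (ay : a * y = y * a).
Hypotheses (xax : x * a * x = x) (yay : y * a * y = y).
Hypotheses (xa : x * a ^+ i.+1 = a ^+ i) (ya : y * a ^+ j.+1 = a ^+ j).

Lemma drazin_inverse_uniq : x = y.
Proof.
have axx : a * x ^+ 2 = x by rewrite expr2 mulrA ax.
have ayy : a * y ^+ 2 = y by rewrite expr2 mulrA ay.
pose l := maxn i j.
have xl : x * a ^+ l.+1 = a ^+ l by rewrite (mulr_exp_stable xa) ?leq_maxl.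
have yl : y * a ^+ l.+1 = a ^+ l by rewrite (mulr_exp_stable ya) ?leq_maxr.
have cx : a ^+ l * x ^+ l.+1 = x ^+ l.+1 * a ^+ l.
  by apply: commrX; apply: commr_sym; apply: commrX.
(* [y] has a left factor [a^l], which [x * a] fixes. Dually [x] has a right factor [a^l], fixed by
   [a * y], so [x = x a y = y]. *)
have xya : x * (a * y) = y.
  by rewrite {1}(range_decomp ayy l) 2!mulrA -[x * a * _]mulrA -exprS xl
    -(range_decomp ayy l).
rewrite -[RHS]xya (range_decomp axx l) cx -mulrA; congr (_ * _).
rewrite mulrA -exprSr.
have -> : a ^+ l.+1 * y = y * a ^+ l.+1.
  by apply: commr_sym; apply: commrX.
by rewrite yl.
Qed.

End DrazinUniqueness.

(** * Adjoints, Moore-Penrose inverses, ranges and orthogonal projectors *)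

Section Matrices.
Variable C : numClosedFieldType.

Lemma adjmxM p r s (M : 'M[C]_(p, r)) (N : 'M[C]_(r, s)) :
  (M *m N)^t* = N^t* *m M^t*.
Proof. by rewrite trmx_mul map_mxM. Qed.

(** If [u] kills the Gram matrix, then [u G] has zero norm, hence vanishes by definiteness of the
    Hermitian form. *)
Lemma gram_unit p r (G : 'M[C]_(p, r)) :
  row_free G -> G *m G^t* \in unitmx.
Proof.
move=> freeG; rewrite -row_free_unit -kermx_eq0; apply/rowV0P => u.
move/sub_kermxP => uGG; apply/eqP; rewrite -(mulmx_free_eq0 _ freeG).
apply: contra_eqT (erefl (dotmx (u *m G) (u *m G))) => /dotmx_is_dotmx.
by rewrite dotmxE adjmxM !mulmxA -(mulmxA u) uGG mul0mx mxE ltxx.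
Qed.

Lemma mpinvP p r (M : 'M[C]_(p, r)) : is_MP M (mpinv M).
Proof.
apply: (@xgetPex _ 0 [set X | is_MP M X]%classic) => /=.
move: (mulmx_base M) (col_base_full M) (row_base_free M).
move: (\rank M) (col_base M) (row_base M) => s F G <- fullF freeG.
have uG := gram_unit freeG.
have uF : F^t* *m F \in unitmx.
  rewrite -{2}[F]trmxCK; apply: gram_unit.
  by rewrite /row_free mxrank_map mxrank_tr.
have hG : (invmx (G *m G^t*))^t* = invmx (G *m G^t*).
  by rewrite trmx_inv map_invmx adjmxM trmxCK.
have hF : (invmx (F^t* *m F))^t* = invmx (F^t* *m F).
  by rewrite trmx_inv map_invmx adjmxM trmxCK.
pose Gi := G^t* *m invmx (G *m G^t*); pose Fi := invmx (F^t* *m F) *m F^t*.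
have GGi : G *m Gi = 1%:M by rewrite mulmxA mulmxV.
have FiF : Fi *m F = 1%:M by rewrite -mulmxA mulVmx.
have MX : F *m G *m (Gi *m Fi) = F *m Fi by rewrite -mulmxA (mulmxA G) GGi mul1mx.
have XM : Gi *m Fi *m (F *m G) = Gi *m G by rewrite -mulmxA (mulmxA Fi) FiF mul1mx.
exists (Gi *m Fi); split.
- by rewrite MX -mulmxA (mulmxA Fi) FiF mul1mx.
- by rewrite XM -mulmxA (mulmxA G) GGi mul1mx.
- by rewrite MX /Fi !adjmxM hF trmxCK mulmxA.
- by rewrite XM /Gi !adjmxM hG trmxCK mulmxA.
Qed.

(** Each matrix fixes the range of the other, so [Q P = P] and [P Q = Q]; taking adjoints identifies
    them. *)
Lemma hermitian_proj_uniq p r s (G : 'M[C]_(p, r)) (H : 'M[C]_(p, s))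
    (P Q : 'M[C]_p) :
  (exists Z, P = G *m Z) -> (exists Z, Q = H *m Z) ->
  P *m H = H -> Q *m G = G -> P^t* = P -> Q^t* = Q -> P = Q.
Proof.
move=> [Z PZ] [Y QY] PH QG hP hQ.
have QP : Q *m P = P by rewrite PZ mulmxA QG.
have PQ : P *m Q = Q by rewrite QY mulmxA PH.
by rewrite -hP -QP adjmxM hP hQ PQ.
Qed.

Lemma mul_mpinv p r (G : 'M[C]_(p, r)) (P : 'M[C]_p) :
  (exists Z, P = G *m Z) -> P *m G = G -> P^t* = P -> G *m mpinv G = P.
Proof.
move=> PZ PG hP; have [GXG _ hGX _] := mpinvP G.
by apply: (hermitian_proj_uniq (G := G) (H := G)); rewrite //; exists (mpinv G).
Qed.

Lemma mxrangeP p r (M : 'M[C]_(p, r)) v :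
  reflect (exists u, v = M *m u) (v \in mxrange M).
Proof.
apply: (iffP memv_imgP) => [[u _ ->]|[u ->]].
  by exists u; rewrite lfunE.
by exists u; rewrite ?memvf ?lfunE.
Qed.

Lemma sub_mxrange p r s (M : 'M[C]_(p, r)) (N : 'M[C]_(p, s)) :
  (exists Z, M = N *m Z) <-> (mxrange M <= mxrange N)%VS.
Proof.
split=> [[Z ->]|sMN].
  apply/subvP => v /mxrangeP[u ->]; apply/mxrangeP.
  by exists (Z *m u); rewrite mulmxA.
(* The factor [Z] is assembled column by column from chosen preimages. *)
have colN j : exists u, col j M = N *m u.
  apply/mxrangeP/(subvP sMN)/mxrangeP; exists (delta_mx j 0).
  by rewrite colE.
have [f fP] := boolp.choice colN.
exists (\matrix_(i, j) f j i 0); apply/matrixP => i j.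
have /matrixP/(_ i 0) := fP j; rewrite !mxE => ->.
by apply: eq_bigr => h _; rewrite !mxE.
Qed.

Lemma eq_mxrange p r s (M : 'M[C]_(p, r)) (N : 'M[C]_(p, s)) :
  mxrange M = mxrange N <-> (exists Z, M = N *m Z) /\ (exists Z, N = M *m Z).
Proof.
split=> [eMN|[/sub_mxrange MN /sub_mxrange NM]].
  by split; apply/sub_mxrange; rewrite eMN subvv.
by apply/eqP; rewrite eqEsubv MN NM.
Qed.

Lemma orthproj_mxrange p r (G : 'M[C]_(p, r)) :
  orthproj (mxrange G) = G *m mpinv G.
Proof.
have [GXG _ hGX _] := mpinvP G.
apply: (@xget_unique _ 0 [set P | is_orthproj (mxrange G) P]%classic) => /=.
  split=> //; first by rewrite mulmxA GXG.
  by apply/eq_mxrange; split; [exists (mpinv G)|exists G].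
move=> Q [QQ hQ /eq_mxrange[QZ [Z GZ]]]; apply/esym/mul_mpinv => //.
by rewrite GZ mulmxA QQ.
Qed.

(** * Index, Drazin inverse and core-EP inverse of a square matrix *)

Section Square.
Variable n : nat.
Implicit Types M X : 'M[C]_n.

Lemma mxindex_le M j Z : M ^+ j = M ^+ j.+1 *m Z -> (mxindex M <= j)%N.
Proof.
move=> MZ; rewrite /mxindex; case: ex_minnP => i _; apply.
rewrite eqn_leq {1}MZ mxrankM_maxl /=.
by rewrite exprSr mxrankM_maxl.
Qed.

Lemma mxindex_le1 (N Y : 'M[C]_n) :
  Y * N ^+ 2 = N -> N * Y = Y * N -> (mxindex N <= 1)%N.
Proof.
move=> YNN NY; apply: (mxindex_le (Z := Y)).
by rewrite mulmxE -(commrX 2 (esym NY : GRing.comm Y N)).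
Qed.

(** Equal rank turns the inclusions of row spaces and of column spaces of consecutive powers into
    equalities, hence a factorisation on each side. *)
Lemma mxindexP M :
  let k := mxindex M in
  exists Y Z, M ^+ k = M ^+ k.+1 *m Y /\ M ^+ k = Z *m M ^+ k.+1.
Proof.
rewrite /mxindex; case: ex_minnP => k rk _ /=.
have [Z MZ] : exists Z, M ^+ k = Z *m M ^+ k.+1.
  apply/submxP; rewrite -(geq_leqif (mxrank_leqif_sup _)) ?(eqP rk) //.
  by apply/submxP; exists M; rewrite exprS.
suff [Y MY] : exists Y, (M ^+ k)^T = Y *m (M ^+ k.+1)^T.
  by exists Y^T, Z; split => //; apply: trmx_inj; rewrite trmx_mul trmxK.
apply/submxP; rewrite -(geq_leqif (mxrank_leqif_sup _)) ?mxrank_tr ?(eqP rk) //.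
by rewrite exprSr trmx_mul submxMl.
Qed.

Lemma drazinP M :
  let X := drazin M in
  [/\ X * M ^+ (mxindex M).+1 = M ^+ mxindex M, X * M * X = X & M * X = X * M].
Proof.
have [Y [Z []]] := mxindexP M; rewrite mulmxE.
set k := mxindex M => MY MZ.
suff : is_drazin M (drazin M).
  rewrite /is_drazin mulmxE => -[MX XMX cMX]; split=> //.
  by rewrite -[RHS]MX; apply: commrX.
apply: (@xgetPex _ 0 [set X | is_drazin M X]%classic) => /=.
have MYj j : M ^+ (k + j) * Y ^+ j = M ^+ k.
  elim: j => [|j IH]; first by rewrite addn0 mulr1.
  rewrite addnS -addSn addnC exprD (exprS Y) -mulrA (mulrA _ Y) -MY mulrA.
  by rewrite -exprD addnC IH.
have ZMj j : Z ^+ j * M ^+ (j + k) = M ^+ k.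
  elim: j => [|j IH]; first by rewrite mul1r.
  by rewrite addSnnS addnC exprD (exprSr Z) -mulrA (mulrA Z) -MZ -exprD addnC.
have YZ j : M ^+ k * Y ^+ j = Z ^+ j * M ^+ k.
  by rewrite -{1}(ZMj j) -mulrA addnC MYj.
have MD : M * (M ^+ k * Y ^+ k.+1) = M ^+ k * Y ^+ k.
  by rewrite mulrA -exprS (exprS Y) mulrA -MY.
have DM : M ^+ k * Y ^+ k.+1 * M = M ^+ k * Y ^+ k.
  by rewrite YZ -mulrA -exprSr (exprSr Z) -mulrA -MZ YZ.
(* This witness also equals [Z^(k+1) M^k]; the two forms together make it commute with [M]. *)
exists (M ^+ k * Y ^+ k.+1); rewrite /is_drazin mulmxE -/k; split.
- by rewrite (exprSr M) -mulrA MD mulrA -exprD MYj.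
- by rewrite -mulrA MD (YZ k.+1) -mulrA (mulrA (M ^+ k)) -exprD MYj.
- by rewrite MD DM.
Qed.

(** The free exponent [j] allows a group inverse to be recognised with [j = 1]. *)
Lemma drazin_eq M X j : X * M ^+ j.+1 = M ^+ j -> X * M * X = X ->
  M * X = X * M -> drazin M = X.
Proof.
move=> XM XMX cMX; have [DM DMD cMD] := drazinP M.
exact: (drazin_inverse_uniq cMD cMX DMD XMX DM XM).
Qed.

(* For an orthogonal projector [M X], the range conditions defining the core-EP
   inverse become equations; any [j] may replace the index. *)
Definition coreEP_rel M X j :=
  [/\ M * X ^+ 2 = X, X * M ^+ j.+1 = M ^+ j & (M *m X)^t* = M *m X].

Lemma coreEP_rel_proj M X j i : coreEP_rel M X j -> (j <= i)%N ->
  (exists Z, M *m X = M ^+ i *m Z) /\ M *m X *m M ^+ i = M ^+ i.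
Proof.
move=> [MXX XM hMX] ji; rewrite mulmxE; split.
  exists (M * X ^+ i.+1).
  by rewrite mulrA -exprSr exprS -mulrA -(range_decomp MXX).
have [Z XZ] : exists Z, M ^+ i = X * Z.
  by exists (M ^+ i.+1); rewrite (mulr_exp_stable XM).
by rewrite XZ mulrA -(mulrA M) -expr2 MXX.
Qed.

(** The orthogonal projectors [M X] and [M Y] have the same range and so coincide; then
    [X = X M X = X M Y = Y]. *)
Lemma coreEP_rel_uniq M X Y i j :
  coreEP_rel M X i -> coreEP_rel M Y j -> X = Y.
Proof.
move=> rX rY; pose l := maxn i j.
have [XZ MXl] := coreEP_rel_proj rX (leq_maxl i j).
have [YZ MYl] := coreEP_rel_proj rY (leq_maxr i j).
have [MXX XM hMX] := rX; have [MYY YM hMY] := rY.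
have eXY := hermitian_proj_uniq XZ YZ MXl MYl hMX hMY.
rewrite -(outer_inverse MXX XM) -mulrA -mulmxE eXY mulmxE.
rewrite {1}(range_decomp MYY l) !mulrA -(mulrA X) -exprS.
by rewrite (mulr_exp_stable XM) ?leq_maxl // -(range_decomp MYY).
Qed.

Lemma coreEP_rel_is_coreEP M X : coreEP_rel M X (mxindex M) -> is_coreEP M X.
Proof.
move=> rX; have [MXX XM hMX] := rX.
have [[Z MXZ] MXk] := coreEP_rel_proj rX (leqnn _).
have XMX := outer_inverse MXX XM.
have XsP : X^t* = M *m X *m X^t*.
  by rewrite -{1}XMX -mulrA -!mulmxE adjmxM hMX.
(* Self-adjointness of [M X] is what moves vectors fixed by [M X] into the range of [X^*]. *)
have PXs : M *m X = X^t* *m M^t* by rewrite -[LHS]hMX adjmxM.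
rewrite /is_coreEP mulmxE XMX; split => //; apply/eq_mxrange; split.
- exists (M^t* *m X); rewrite mulmxA -PXs -mulmxA mulmxE -expr2 MXX //.
- exists (M ^+ (mxindex M).+1 *m Z *m X^t*).
  by rewrite {1}XsP MXZ -XM mulmxE !mulrA.
- by exists (Z *m X^t*); rewrite mulmxA -MXZ.
- by exists (M^t* *m M ^+ mxindex M); rewrite mulmxA -PXs.
Qed.

Lemma is_coreEP_rel M X : is_coreEP M X -> coreEP_rel M X (mxindex M).
Proof.
have [Y [Z [MY _]]] := mxindexP M; set k := mxindex M in MY *.
case=> XMX /eq_mxrange[[Z3 X3] [Z4 X4]] /eq_mxrange[[Z1 X1] [Z2 X2]].
have XM : X * M ^+ k.+1 = M ^+ k.
  by rewrite exprS -mulmxE X2 X4 !mulmxA XMX.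
have MXk : M *m X *m M ^+ k = M ^+ k.
  by rewrite MY !mulmxE mulrA -(mulrA M) XM -exprS.
have [GXG _ hP _] := mpinvP (M ^+ k).
(* The columns of [X^*] lie in the range of [M^k], so the projector fixes [X^*]; this is the adjoint
   statement. *)
have XP : X *m (M ^+ k *m mpinv (M ^+ k)) = X.
  by rewrite -[LHS]trmxCK adjmxM hP X1 mulmxA GXG -X1 trmxCK.
have MXP : M *m X = M ^+ k *m mpinv (M ^+ k).
  by rewrite -{1}XP !mulmxA MXk.
split=> //; last by rewrite MXP.
by rewrite expr2 mulrA -mulmxE {2}X3 X1 !mulmxA MXk -X1 -X3.
Qed.

(** The witness is the Drazin inverse times the orthogonal projector [P] onto the range of [M^k]:
    the Drazin inverse preserves this range and inverts [M] there. *)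
Lemma coreEP_exists M : exists X, coreEP_rel M X (mxindex M).
Proof.
have [DM DMD cMD] := drazinP M.
set k := mxindex M in DM *.
have [GXG _ hP _] := mpinvP (M ^+ k).
set P := M ^+ k *m mpinv (M ^+ k) in GXG hP.
have MDk : M * drazin M * M ^+ k = M ^+ k.
  by rewrite cMD -mulrA -exprS.
have MDP : M *m (drazin M *m P) = P.
  by rewrite /P !mulmxA mulmxE MDk.
have PDP : P *m (drazin M *m P) = drazin M *m P.
  have -> : drazin M *m P = M ^+ k *m (drazin M *m mpinv (M ^+ k)).
    by rewrite /P !mulmxA mulmxE; congr (_ * _); apply: commrX.
  by rewrite mulmxA GXG.
exists (drazin M *m P); split; last by rewrite MDP.
  by rewrite expr2 mulrA -mulmxE MDP PDP.
by rewrite exprSr mulrA -mulmxE -(mulmxA (drazin M)) GXG mulmxE -mulrA -exprSr.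
Qed.

Lemma coreEPP M : coreEP_rel M (coreEP M) (mxindex M).
Proof.
apply: is_coreEP_rel.
apply: (@xgetPex _ 0 [set X | is_coreEP M X]%classic) => /=.
by have [X /coreEP_rel_is_coreEP] := coreEP_exists M; exists X.
Qed.

Lemma coreEP_eq M X j : coreEP_rel M X j -> coreEP M = X.
Proof. exact/coreEP_rel_uniq/coreEPP. Qed.

Lemma coreEP_exp M m :
  coreEP (M ^+ m.+1) = coreEP M ^+ m.+1.
Proof.
have [MXX XM hMX] := coreEPP M; set k := mxindex M in XM.
set X := coreEP M in MXX XM hMX *.
have MX : M ^+ m.+1 * X ^+ m.+1 = M * X.
  by rewrite exprS -mulrA -(range_decomp MXX).
(* The index of [M] is a large enough exponent for the power too, so the index of [M^(m+1)] is never
   computed. *)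
apply: (coreEP_eq (j := k)); split; last by rewrite mulmxE MX.
  by rewrite -exprM muln2 -addnn addnS (exp_mul_expX MXX).
rewrite -!exprM mulnS (expX_mul_exp XM) //.
by rewrite leq_pmull.
Qed.

End Square.

(** * Weighted inverses expressed through [M = WA], and the seven representations *)

Section Weighted.
Variables (q n : nat) (W : 'M[C]_(n, q)).
Implicit Type A : 'M[C]_(q, n).

Lemma wpowS A l : wpow W A l.+1 = A *m (W *m A) ^+ l.
Proof.
elim: l => [|l IH]; first by rewrite mulmx1.
have -> : wpow W A l.+2 = wprod W A (wpow W A l.+1) by [].
by rewrite IH /wprod exprS -!mulmxE !mulmxA.
Qed.

Lemma WwpowE A l : Wwpow W A l = (W *m A) ^+ l.
Proof. by case: l => // l; rewrite /Wwpow wpowS exprS mulmxA. Qed.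

Lemma exp_mulmxC A l : (W *m A) ^+ l *m W = W *m (A *m W) ^+ l.
Proof.
elim: l => [|l IH]; first by rewrite mulmx1 mul1mx.
by rewrite exprSr exprS -!mulmxE -mulmxA -[W *m A *m W]mulmxA mulmxA IH
  -mulmxA; congr (_ *m _); rewrite mulmxE -exprSr exprS.
Qed.

(** The weight disappears because [W] times the weighted core-EP inverse is [M X^2 = X]. *)
Lemma mul_wwgm A m :
  W *m wwgm W m A = coreEP (W *m A) ^+ m.+1 *m (W *m A) ^+ m.
Proof.
have [MXX _ _] := coreEPP (W *m A).
rewrite /wwgm WwpowE wpowS /wcoreEP !mulmxA; congr (_ *m _).
by move: MXX; rewrite expr2 mulrA mulmxE => ->; rewrite -exprS.
Qed.

Variable A : 'M[C]_(q, n).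
Let M := W *m A.
Let X := coreEP M.
Let k := maxn (mxindex (A *m W)) (mxindex M).

Lemma wwgmMP_coreEP m : wwgmMP W m A = X ^+ m.+1 *m M ^+ m.+1 *m mpinv A.
Proof.
rewrite /wwgmMP mul_wwgm -[_ *m W *m A]mulmxA -[_ *m _ *m (W *m A)]mulmxA.
by rewrite (exprSr M) -mulmxE.
Qed.

Section WeakGroupOfCore.
Variable m : nat.
Let B := (A *m W) ^+ m *m wcoreEP W A *m W *m A.

Lemma mulWB : W *m B = M ^+ m.+1 * X ^+ 2 * M.
Proof.
rewrite /B /wcoreEP !mulmxA -exp_mulmxC.
by rewrite -!(mulmxA _ W A) -/M -/X mulmxE -exprSr expr2 !mulrA.
Qed.

Lemma wgm_group : [/\ X ^+ m.+1 * M * (W *m B) ^+ 2 = W *m B,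
  W *m B * (X ^+ m.+1 * M) = X ^+ m.+1 * M * (W *m B)
  & X ^+ m.+1 * M * (W *m B) * (X ^+ m.+1 * M) = X ^+ m.+1 * M].
Proof.
have [MXX XM _] := coreEPP M; rewrite mulWB.
exact: (weak_group_inverse MXX XM).
Qed.

(** The group inverse [D] of [WB] bounds the index of [WB]. For [BW], combining [B = B X M] with
    [X M = (WB)^2 D^2] gives [BW = (BW)^2 (B D^2 W)]. *)
Lemma mxindex_wgm_group :
  (maxn (mxindex (B *m W)) (mxindex (W *m B)) <= 1)%N.
Proof.
have [DTT TD DTD] := wgm_group; set D := X ^+ m.+1 * M in DTT TD DTD.
rewrite geq_max (mxindex_le1 DTT TD) andbT.
apply: (@mxindex_le _ _ _ (B *m D ^+ 2 *m W)).
have [MXX XM _] := coreEPP M.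
have BXM : B *m X *m M = B.
  rewrite /B /wcoreEP -!(mulmxA _ W A) -/M -/X (mulmxA _ A) -!(mulmxA (_ *m A)).
  by rewrite mulmxE (expX_mul_expX MXX XM 1 0).
have TTDD : (W *m B) * (W *m B) * D ^+ 2 = X * M.
  rewrite expr2 mulrA -(mulrA (W *m B) _ D) TD -mulrA DTD TD /D mulWB.
  exact: weak_group_mul MXX XM m.
clearbody B D; rewrite expr1 expr2 -[in LHS]BXM -(mulmxA B).
by rewrite -[X *m M]/(X * M) -TTDD expr2 -!mulmxE !mulmxA.
Qed.

Lemma wwgmMP_group :
 wwgmMP W m A = W *m wdrazin W B *m Wwpow W A m *m mpinv A.
Proof.
have [DTT TD DTD] := wgm_group; rewrite wwgmMP_coreEP.
rewrite /wdrazin (drazin_eq DTT DTD TD) WwpowE mulmxA mulmxE.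
rewrite expr2 mulrA TD DTD.
by rewrite (exprS M) mulrA.
Qed.

End WeakGroupOfCore.

Lemma wwgmMP_drazin m : wwgmMP W m A =
        drazin (W *m A) ^+ m.+1 *m orthproj (mxrange ((W *m A) ^+ k))
          *m Wwpow W A m.+1 *m mpinv A.
Proof.
have [MXX XM hMX] := coreEPP M.
have [DM DMD cMD] := drazinP M.
have [MXZ MXk] := coreEP_rel_proj (coreEPP M) (leq_maxr _ _ : mxindex M <= k)%N.
rewrite wwgmMP_coreEP WwpowE orthproj_mxrange (mul_mpinv MXZ MXk hMX).
congr (_ *m _ *m _); rewrite -/M -/X.
set i := mxindex M in DM XM.
(* The exponent [m + i] makes [M X] start with [M^(m+1+i)], which the power of the Drazin inverse
   lowers to [M^i]. *)
rewrite mulmxE {2}[X](range_decomp MXX (m + i)) (mulrA M) -exprS -addSn mulrA.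
by rewrite (expX_mul_exp DM) // addSn addnC (exp_mul_expX MXX).
Qed.

Lemma exp_mxindex_range l : exists Z, M ^+ mxindex M = M ^+ l *m Z.
Proof.
have [MXX _ _] := coreEPP M.
have [_ MXk] := coreEP_rel_proj (coreEPP M) (leqnn _).
exists (M * X ^+ l.+1 *m M ^+ mxindex M).
rewrite -{1}MXk -/X mulmxA; congr (_ *m _).
by rewrite {1}[X](range_decomp MXX l) !mulmxE !mulrA -exprS exprSr.
Qed.

(** Shared core of items (3) and (4), used with [E = M^l W] and with [E = W Q], where [Q] projects
    onto the range of [(AW)^k]. *)
Lemma mul_mpinv_exp r (E : 'M[C]_(n, r)) m :
  (exists Z, E = M ^+ mxindex M *m Z) ->
  (exists Z, M ^+ mxindex M = M ^+ m.+1 *m E *m Z) ->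
  E *m mpinv (M ^+ m.+1 *m E) = X ^+ m.+1.
Proof.
move=> [Z1 EZ] [Z2 MZ]; have [MXX XM hMX] := coreEPP M.
have [[Z MXZ] MXk] := coreEP_rel_proj (coreEPP M) (leqnn _).
set i := mxindex M in XM EZ MZ MXZ MXk.
have EX : E = X ^+ m.+1 *m (M ^+ m.+1 *m E).
  by rewrite {2}EZ !mulmxA mulmxE -mulrA -exprD (expX_mul_exp XM).
rewrite {1}EX -mulmxA (mul_mpinv (P := M *m X)) //.
- by rewrite mulmxA mulmxE -{2}[X]expr1 (expX_mul_expX MXX XM) addn0.
- by exists (Z2 *m Z); rewrite mulmxA -MZ.
have -> : M ^+ m.+1 *m E = M ^+ i *m (M ^+ m.+1 *m Z1).
  by rewrite EZ !mulmxA !mulmxE -!exprD addnC.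
by rewrite mulmxA MXk.
Qed.

Lemma wwgmMP_mpinv_exp m l : (k <= l)%N -> wwgmMP W m A =
          Wwpow W A l *m W *m mpinv (Wwpow W A (l + m).+1 *m W)
            *m Wwpow W A m.+1 *m mpinv A.
Proof.
move=> /(leq_trans (leq_maxr _ _)) Ml.
(* The extra factor [M = W A] supplies the [W] that ends [E]; the remaining [A Z] is the witness. *)
have [Z MZ] := exp_mxindex_range (m.+1 + l.+1).
rewrite wwgmMP_coreEP !WwpowE; congr (_ *m _ *m _).
rewrite -addnS addnC exprD -mulmxE -(mulmxA (M ^+ m.+1)) mul_mpinv_exp //.
  exists (M ^+ (l - mxindex M) *m W).
  by rewrite mulmxA mulmxE -exprD subnKC.
by exists (A *m Z); rewrite MZ exprD (exprSr M l) -!mulmxE !mulmxA.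
Qed.

Lemma wwgmMP_mpinv_orthproj m : wwgmMP W m A =
          W *m mpinv (Wwpow W A m.+1 *m W *m
                      orthproj (mxrange ((A *m W) ^+ k)))
          *m Wwpow W A m.+1 *m mpinv A.
Proof.
have Mk : (mxindex M <= k)%N by apply: leq_maxr.
have [QN _ hQ _] := mpinvP ((A *m W) ^+ k).
rewrite wwgmMP_coreEP !WwpowE orthproj_mxrange; congr (_ *m _ *m _).
set Q := _ *m mpinv _ in QN hQ *.
set G := _ *m W *m Q.
(* [G^+ = (G^+ G)^* G^+] starts with [G^*], hence with [Q], which is idempotent. This inserts the
   [Q] needed for [E = W Q]. *)
have QG : Q *m mpinv G = mpinv G.
  have [_ GGG _ hGG] := mpinvP G.
  rewrite -GGG -hGG adjmxM !mulmxA; congr (_ *m _ *m _).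
  rewrite /G adjmxM hQ mulmxA; congr (_ *m _).
  by rewrite /Q mulmxA QN.
rewrite -QG mulmxA /G -(mulmxA (M ^+ m.+1)) mul_mpinv_exp //.
  exists (M ^+ (k - mxindex M) *m W *m mpinv ((A *m W) ^+ k)).
  by rewrite !mulmxA mulmxE -exprD subnKC // exp_mulmxC -mulmxA.
have [Z MZ] := exp_mxindex_range (m.+1 + k.+1).
clearbody Q; exists ((A *m W) ^+ k *m A *m Z).
rewrite MZ !mulmxA -(mulmxA _ Q) QN -(mulmxA _ W) -exp_mulmxC exprD (exprSr M k).
by rewrite -!mulmxE !mulmxA.
Qed.

Lemma wwgmMP_wwg m : (0 < m)%N -> wwgmMP W m A =
            Wwpow W A m.-1 *m W *m wwg W (wpow W A m) *m W *m A *m mpinv A.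
Proof.
case: m => // m _; rewrite wwgmMP_coreEP; congr (_ *m _).
have [MXX XM hMX] := coreEPP M.
rewrite WwpowE -[_ *m W *m wwg _ _]mulmxA mul_wwgm.
(* The unweighted matrix behind [A^{*m}] is thus a power of [M], whose core-EP inverse is the same
   power of [X]. *)
have -> : W *m wpow W A m.+1 = M ^+ m.+1 by rewrite wpowS exprS mulmxA.
rewrite coreEP_exp -mulmxA -exprM expr1 mulmxA -mulmxA -/M -/X.
rewrite (exprSr M m.+1) -mulmxE mulmxA [M ^+ _ *m _]mulmxA /=.
congr (_ *m _ *m _).
rewrite mulmxE muln2 -addnn addSn; exact: esym (exp_mul_expX MXX m m.+1).
Qed.

Lemma wwgmMP_wg m : (0 < m)%N ->
          wwgmMP W m A = wg (W *m A) ^+ m *m Wwpow W A m *m mpinv A.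
Proof.
case: m => // m _; rewrite wwgmMP_coreEP; congr (_ *m _).
have [MXX XM hMX] := coreEPP M.
rewrite WwpowE /wg /wgm expr1 mulmxE (expr_weak_group MXX XM).
by rewrite (exprS M) mulrA.
Qed.

Lemma wwgmMP_wgm m : wwgmMP W m A = wgm m (W *m A) *m W *m A *m mpinv A.
Proof.
rewrite wwgmMP_coreEP /wgm; congr (_ *m _); rewrite -[RHS]mulmxA -[RHS]mulmxA.
by rewrite (exprSr M) -mulmxE.
Qed.

End Weighted.
End Matrices.

Theorem theorem3p8 (R : realType) (q n : nat)
    (A : 'M[complex R]_(q, n)) (W : 'M[complex R]_(n, q)) (m : nat)
    (hW : W != 0) (hm : (0 < m)%N) :
  let k := maxn (mxindex (A *m W)) (mxindex (W *m A)) in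
  [/\ (* (1) *)
      (let B := (A *m W) ^+ m *m wcoreEP W A *m W *m A in
       (maxn (mxindex (B *m W)) (mxindex (W *m B)) <= 1)%N /\
       wwgmMP W m A = W *m wdrazin W B *m Wwpow W A m *m mpinv A),
      (* (2) *)
      wwgmMP W m A =
        drazin (W *m A) ^+ m.+1 *m orthproj (mxrange ((W *m A) ^+ k))
          *m Wwpow W A m.+1 *m mpinv A,
      (* (3) *)
      (forall l : nat, (k <= l)%N ->
        wwgmMP W m A =
          Wwpow W A l *m W *m mpinv (Wwpow W A (l + m).+1 *m W)
            *m Wwpow W A m.+1 *m mpinv A),
      (* (4) *)
      wwgmMP W m A =
        W *m mpinv (Wwpow W A m.+1 *m W *m
                      orthproj (mxrange ((A *m W) ^+ k)))
          *m Wwpow W A m.+1 *m mpinv A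
    & [/\ (* (5) *)
          wwgmMP W m A =
            Wwpow W A m.-1 *m W *m wwg W (wpow W A m) *m W *m A *m mpinv A,
          (* (6) *)
          wwgmMP W m A = wg (W *m A) ^+ m *m Wwpow W A m *m mpinv A
        & (* (7) *)
          wwgmMP W m A = wgm m (W *m A) *m W *m A *m mpinv A]].
Proof.
split.
- by split; [exact: mxindex_wgm_group|exact: wwgmMP_group].
- exact: wwgmMP_drazin.
- exact: wwgmMP_mpinv_exp.
- exact: wwgmMP_mpinv_orthproj.
- by split; [exact: wwgmMP_wwg|exact: wwgmMP_wg|exact: wwgmMP_wgm].
Qed.
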